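(* Let $p,q>1$ be real numbers with $\frac1p+\frac1q=1$, let $X_1,X_2$ be reflexive Banach spaces and let $\{Y_i\}_{i=1}^\infty$ be a family of reflexive Banach spaces. Let $\Lambda=\{\Lambda_i\in B(X_2,Y_i)\}_{i=1}^\infty$ be a $qg$-Riesz basis for $X_2^*$ with respect to $\{Y_i\}_{i=1}^\infty$ and let $\Theta=\{\Theta_i\in B(X_1^*,Y_i^* )\}_{i=1}^\infty$ be a $pg$-Riesz basis for $X_1$ with respect to $\{Y_i^*\}_{i=1}^\infty$. If the complex sequence $m=\{m_i\}_{i=1}^\infty$ satisfies $0<\inf_{i\in\mathbb N}|m_i|\le \sup_{i\in\mathbb N}|m_i|<+\infty$, then the operator $\mathbf{M}_{m,\Lambda,\Theta}:X_1^*\to X_2^*$, $\mathbf{M}_{m,\Lambda,\Theta}(g)=\sum_{i=1}^\infty m_i\Lambda_i^*\Theta_i g$, is invertible.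
   Context: Scalars are complex; $B(Z,W)$ is the space of bounded linear operators $Z\to W$; $\Lambda_i^*$ is the Banach-space adjoint; reflexive spaces are identified with their biduals (so $X_1^{**}=X_1$, $Y_i^{**}=Y_i$). Riesz bases: let $1<r<\infty$, let $Z$ be a Banach space and $\{W_i\}_{i=1}^\infty$ Banach spaces. A family $\{\Gamma_i\in B(Z,W_i)\}_{i=1}^\infty$ is an $rg$-Riesz basis for $Z^*$ with respect to $\{W_i\}$ if (i) $\{f\in Z:\Gamma_i f=0 \text{ for all } i\}=\{0\}$, and (ii) there are constants $A,B>0$ (the bounds) such that for every finite $I_1\subset\mathbb N$ and all $g_i\in W_i^*$ $(i\in I_1)$, $$A\Big(\sum_{i\in I_1}\|g_i\|^r\Big)^{1/r}\le\Big\|\sum_{i\in I_1}\Gamma_i^*g_i\Big\|\le B\Big(\sum_{i\in I_1}\|g_i\|^r\Big)^{1/r}.$$ Thus ''$qg$-Riesz basis for $X_2^*$ with respect to $\{Y_i\}$'' is the case $r=q$, $Z=X_2$, $W_i=Y_i$, and ''$pg$-Riesz basis for $X_1$ with respect to $\{Y_i^*\}$'' is the case $r=p$, $Z=X_1^*$ (so $Z^*=X_1$), $W_i=Y_i^*$. The series defining $\mathbf{M}_{m,\Lambda,\Theta}$ converges in norm; $\mathbf{M}_{m,\Lambda,\Theta}$ is called the $(p,q)g$-Bessel multiplier of $\Lambda,\Theta,m$. ''Invertible'' means bounded, bijective and with bounded inverse. *)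

(* Defs.v *)
From HB Require Import structures.
From mathcomp Require Import all_boot all_order all_algebra.
From mathcomp Require Import finmap complex.
From mathcomp Require Import all_classical all_reals all_analysis.

Set Implicit Arguments.
Unset Strict Implicit.
Unset Printing Implicit Defensive.

Import Order.TTheory GRing.Theory Num.Theory.
Import numFieldNormedType.Exports.

Local Open Scope classical_set_scope.
Local Open Scope ring_scope.
Local Open Scope complex_scope.

(* The scalars themselves are given the normed structure, not (R[i])^o: the
   library already declares completeness of R^o for R : realType, and a second
   canonical instance on the same head symbol is not possible. *)
HB.instance Definition _ (R : realType) := NormedModule.copy R[i] (R[i])^o.

(* Over the scalars R[i] the library norm `|x| takes its values in R[i]; it is
   always a nonnegative real number, and rnorm x is that number seen in R. *)
Definition rnorm (R : realType) (V : normedModType R[i]) (x : V) : R :=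
  complex.Re `|x|.

Section rnorm_theory.
Variable R : realType.

Lemma rnormE (V : normedModType R[i]) (x : V) : `|x| = (rnorm x)%:C.
Proof. by rewrite /rnorm (RRe_real (normr_real x)). Qed.

Lemma rnorm_ge0 (V : normedModType R[i]) (x : V) : 0 <= rnorm x.
Proof. by rewrite -lecR -rnormE; exact: normr_ge0. Qed.

Lemma rnormD (V : normedModType R[i]) (x y : V) :
  rnorm (x + y) <= rnorm x + rnorm y.
Proof. by rewrite -lecR rmorphD /= -!rnormE ler_normD. Qed.

Lemma rnorm0 (V : normedModType R[i]) : rnorm (0 : V) = 0.
Proof. by rewrite /rnorm normr0. Qed.

Lemma rnorm0_eq0 (V : normedModType R[i]) (x : V) : rnorm x = 0 -> x = 0.
Proof. by move=> x0; apply/normr0_eq0; rewrite rnormE x0. Qed.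

Lemma rnormZ (V : normedModType R[i]) (a : R[i]) (x : V) :
  rnorm (a *: x) = rnorm (a : R[i]) * rnorm x.
Proof.
by apply: (@complexI R); rewrite rmorphM /= -!rnormE normrZ.
Qed.

End rnorm_theory.

Section complex_complete.
Variable R : realType.

Lemma gt0_complexE (e : R[i]) : 0 < e ->
  exists2 d : R, 0 < d & e = d%:C.
Proof.
move=> e0; exists (complex.Re e).
  by rewrite -(ltcR 0) (RRe_real (gtr0_real e0)).
by rewrite (RRe_real (gtr0_real e0)).
Qed.

Lemma rnorm_complexE (z : R[i]) :
  rnorm z = Num.sqrt (complex.Re z ^+ 2 + complex.Im z ^+ 2).
Proof. by rewrite /rnorm normc_def. Qed.

Lemma Re_le_rnorm (z : R[i]) : `|complex.Re z| <= rnorm z.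
Proof. by rewrite rnorm_complexE -sqrtr_sqr ler_wsqrtr// lerDl sqr_ge0. Qed.

Lemma Im_le_rnorm (z : R[i]) : `|complex.Im z| <= rnorm z.
Proof. by rewrite rnorm_complexE -sqrtr_sqr ler_wsqrtr// lerDr sqr_ge0. Qed.

Lemma rnorm_le_ReIm (z : R[i]) :
  rnorm z <= `|complex.Re z| + `|complex.Im z|.
Proof.
rewrite rnorm_complexE -[leRHS]ger0_norm ?addr_ge0// -sqrtr_sqr ler_wsqrtr//.
rewrite sqrrD !real_normK ?num_real// addrAC lerDl.
by rewrite mulrn_wge0// mulr_ge0.
Qed.

Lemma cvg_of_cauchy_bound (F : set_system R[i]) (h : R[i] -> R) :
  ProperFilter F -> cauchy F ->
  (forall x y, `|h x - h y| <= rnorm (x - y)) -> cvg (h @ F).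
Proof.
move=> FF /cauchy_ballP Fc hle; apply: R_complete; apply/cauchy_ballP => e e0.
have /Fc : 0 < e%:C by rewrite -(ltcR 0) in e0.
case=> -[A B] [/= FA FB] AB; exists (h @` A, h @` B).
  split; [apply: filterS FA|apply: filterS FB]; exact: preimage_image.
case=> _ _ [/= [x Ax <-] [y By <-]]; have /= := AB (x, y) (conj Ax By).
by rewrite -!ball_normE /= rnormE ltcR; exact/le_lt_trans/hle.
Qed.

Lemma complex_complete (F : set_system R[i]) :
  ProperFilter F -> cauchy F -> cvg F.
Proof.
move=> FF Fc.
have ReB (x y : R[i]) :
    complex.Re x - complex.Re y = complex.Re (x - y) by case: x y => ? ? [].
have ImB (x y : R[i]) :
    complex.Im x - complex.Im y = complex.Im (x - y) by case: x y => ? ? [].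
have /cvg_ex[a Fa] : cvg ((@complex.Re R : R[i] -> R) @ F).
  by apply: cvg_of_cauchy_bound => // x y; rewrite ReB Re_le_rnorm.
have /cvg_ex[b Fb] : cvg ((@complex.Im R : R[i] -> R) @ F).
  by apply: cvg_of_cauchy_bound => // x y; rewrite ImB Im_le_rnorm.
apply/cvg_ex; exists (a +i* b : R[i]).
apply/cvgrPdist_lt => _ /gt0_complexE[e e0 ->].
move/cvgrPdist_lt : Fa => /(_ (e / 2)) Fa.
move/cvgrPdist_lt : Fb => /(_ (e / 2)) Fb.
near=> z; rewrite rnormE ltcR (le_lt_trans (rnorm_le_ReIm _))//.
rewrite -ReB -ImB /= (splitr e) ltrD//.
- by near: z; apply: Fa; rewrite divr_gt0.
- by near: z; apply: Fb; rewrite divr_gt0.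
Unshelve. all: by end_near. Qed.

HB.instance Definition _ := Uniform_isComplete.Build R[i] complex_complete.
End complex_complete.

Section bounded_operators.
Variables (R : realType) (Z W : normedModType R[i]).

Definition bounded_operator : {pred Z -> W} :=
  [pred f | `[< linear f /\ exists M : R, forall x, rnorm (f x) <= M * rnorm x >]].

Lemma bounded_operatorP (f : Z -> W) :
  reflect (linear f /\ exists M : R, forall x, rnorm (f x) <= M * rnorm x)
          (f \in bounded_operator).
Proof. exact: asboolP. Qed.

Lemma bounded_operator_submod_closed : submod_closed bounded_operator.
Proof.
split.
  apply/bounded_operatorP; split; first by move=> a x y; rewrite /= scaler0 addr0.
  by exists 0 => x; rewrite rnorm0 mul0r.
move=> a f g /bounded_operatorP[lf [M fM]] /bounded_operatorP[lg [N gN]].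
apply/bounded_operatorP; split.
  move=> b x y; rewrite !fctE lf lg !scalerDr !scalerA [a * b]mulrC.
  by rewrite -!addrA; congr (_ + _); rewrite addrCA.
exists (rnorm (a : R[i]) * M + N) => x; rewrite !fctE.
apply: (le_trans (rnormD _ _)); rewrite mulrDl lerD// rnormZ -mulrA.
by rewrite ler_wpM2l ?rnorm_ge0.
Qed.

HB.instance Definition _ := GRing.isSubmodClosed.Build R[i] (Z -> W)
  bounded_operator bounded_operator_submod_closed.

Record bop := Bop {
  bop_fun :> Z -> W ;
  bop_funP : bop_fun \in bounded_operator }.

HB.instance Definition _ := [isSub for bop_fun].
HB.instance Definition _ := [Choice of bop by <:].
HB.instance Definition _ := [SubChoice_isSubLmodule of bop by <:].
End bounded_operators.

Section operator_norm.
Variables (R : realType) (Z W : normedModType R[i]).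
Implicit Types f g : bop Z W.

Lemma bopP f g : (forall x, f x = g x) <-> f = g.
Proof. by split=> [fg|->//]; apply: val_inj; exact/funext. Qed.

Lemma bop_linear f : linear f.
Proof. by have /bounded_operatorP[] := bop_funP f. Qed.

HB.instance Definition _ f :=
  GRing.isLinear.Build R[i] Z W *:%R f (bop_linear f).

Lemma bopD f g x : (f + g) x = f x + g x. Proof. by []. Qed.
Lemma bopN f x : (- f) x = - f x. Proof. by []. Qed.
Lemma bopZ (a : R[i]) f x : (a *: f) x = a *: f x. Proof. by []. Qed.

Definition opnorm f : R := sup [set rnorm (f x) | x in [set x | rnorm x <= 1]].

Lemma opnorm_has_sup f :
  has_sup [set rnorm (f x) | x in [set x | rnorm x <= 1]].
Proof.
split; first by exists (rnorm (f 0)); exists 0 => //=; rewrite rnorm0.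
have /bounded_operatorP[_ [M fM]] := bop_funP f.
exists (Num.max M 0) => _ [x /= x1 <-]; apply: (le_trans (fM x)).
apply: (@le_trans _ _ (Num.max M 0 * rnorm x)).
  by rewrite ler_wpM2r ?rnorm_ge0// le_max lexx.
by rewrite ler_piMr// le_max lexx orbT.
Qed.

Lemma opnorm_ge0 f : 0 <= opnorm f.
Proof.
have [_ ub] := opnorm_has_sup f; apply: le_trans (ub_le_sup ub _).
  exact: (rnorm_ge0 (f 0)).
by exists 0 => //=; rewrite rnorm0 ler01.
Qed.

Lemma opnorm_le f x : rnorm (f x) <= opnorm f * rnorm x.
Proof.
have [->|x0] := eqVneq x 0; first by rewrite linear0 !rnorm0 mulr0.
have nx0 : 0 < rnorm x.
  by rewrite lt_neqAle rnorm_ge0 andbT eq_sym; apply: contra_neq x0 => /rnorm0_eq0.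
rewrite -ler_pdivrMr//.
have rV : rnorm ((rnorm x)^-1%:C : R[i]) = (rnorm x)^-1.
  by rewrite rnorm_complexE /= expr0n addr0 sqrtr_sqr ger0_norm// invr_ge0 ltW.
have [_ ub] := opnorm_has_sup f; apply: ub_le_sup => //.
exists ((rnorm x)^-1%:C *: x) => /=.
  by rewrite rnormZ rV mulVf// gt_eqF.
by rewrite linearZ /= rnormZ rV mulrC.
Qed.

Lemma opnorm_le_bound f (M : R) : 0 <= M ->
  (forall x, rnorm (f x) <= M * rnorm x) -> opnorm f <= M.
Proof.
move=> M0 fM; apply: ge_sup; first by case: (opnorm_has_sup f).
by move=> _ [x /= x1 <-]; rewrite (le_trans (fM x))// ler_piMr.
Qed.

Let norm f : R[i] := (opnorm f)%:C.

Let ler_normD f g : norm (f + g) <= norm f + norm g.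
Proof.
rewrite /norm -rmorphD /= lecR; apply: opnorm_le_bound.
  by rewrite addr_ge0 ?opnorm_ge0.
by move=> x; rewrite bopD (le_trans (rnormD _ _))// mulrDl lerD ?opnorm_le.
Qed.

Let normrZ (a : R[i]) f : norm (a *: f) = `|a| * norm f.
Proof.
have opnormZ_le (b : R[i]) h : opnorm (b *: h) <= rnorm (b : R[i]) * opnorm h.
  apply: opnorm_le_bound; first by rewrite mulr_ge0 ?rnorm_ge0 ?opnorm_ge0.
  by move=> x; rewrite bopZ rnormZ -mulrA ler_wpM2l ?rnorm_ge0 ?opnorm_le.
rewrite (rnormE (a : R[i])) /norm -rmorphM /=; congr (_%:C).
apply/le_anti; rewrite opnormZ_le /=.
have [->|a0] := eqVneq a 0; first by rewrite rnorm0 mul0r opnorm_ge0.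
have na0 : 0 < rnorm (a : R[i]).
  by rewrite lt_neqAle rnorm_ge0 andbT eq_sym; apply: contra_neq a0 => /rnorm0_eq0.
rewrite -ler_pdivlMl//.
have -> : (rnorm (a : R[i]))^-1 = rnorm (a^-1 : R[i]).
  by apply: (@complexI R); rewrite fmorphV /= -!rnormE normfV.
by rewrite -[in leLHS](scale1r f) -(mulVf a0) -scalerA opnormZ_le.
Qed.

Let normr0_eq0 f : norm f = 0 -> f = 0.
Proof.
move=> /(@complexI R _ 0) f0; apply/bopP => x; apply: rnorm0_eq0.
by apply/le_anti; rewrite rnorm_ge0 (le_trans (opnorm_le _ _))// f0 mul0r.
Qed.

HB.instance Definition _ :=
  Lmodule_isNormed.Build R[i] (bop Z W) ler_normD normrZ normr0_eq0.

Lemma rnorm_bop f : rnorm f = opnorm f. Proof. by []. Qed.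

End operator_norm.

Section bop_complete.
Variables (R : realType) (Z : normedModType R[i]).
Variable W : completeNormedModType R[i].

Lemma bop_complete (F : set_system (bop Z W)) :
  ProperFilter F -> cauchy F -> cvg F.
Proof.
move=> FF /cauchy_ballP Fc.
have Fc_le (e : R) : 0 < e -> exists2 S : set (bop Z W), F S &
    forall f g x, S f -> S g -> rnorm (f x - g x) <= e * rnorm x.
  move=> e0; have /Fc[[A B] [/= FA FB] AB] : 0 < e%:C by rewrite ltcR.
  have e20 : 0 < (e / 2)%:C by rewrite ltcR divr_gt0.
  have [[C D] [/= FC FD] CD] := Fc _ e20.
  exists (C `&` D); first exact: filterI.
  move=> f g x [Cf _] [_ Dg].
  have /= := CD (f, g) (conj Cf Dg).
  rewrite -ball_normE /= rnormE ltcR => fg.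
  apply: (le_trans (opnorm_le (f - g) x)); rewrite ler_wpM2r ?rnorm_ge0//.
  by rewrite (le_trans (ltW fg))// ler_pdivrMr// ler_peMr ?ler1n// ltW.
have Fx x : cvg ((fun f : bop Z W => f x) @ F).
  apply: cauchy_cvg; apply/cauchy_ballP => _ /gt0_complexE[e e0 ->].
  have xp : 0 < rnorm x + 1 by rewrite ltr_pwDr ?rnorm_ge0.
  have [|S FS SP] := Fc_le (e / (rnorm x + 1)); first by rewrite divr_gt0.
  exists ((fun f : bop Z W => f x) @` S, (fun f : bop Z W => f x) @` S).
    by split; apply: (@filterS _ F FF S _ _ FS) => f Sf; exists f.
  case=> _ _ [/= [f Sf <-] [g Sg <-]].
  rewrite -ball_normE /= rnormE ltcR (le_lt_trans (SP f g x Sf Sg))//.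
  by rewrite mulrAC ltr_pdivrMr// ltr_pM2l// ltrDl.
pose L x : W := lim ((fun f : bop Z W => f x) @ F).
have FL x : (fun f : bop Z W => f x) @ F --> L x by exact: Fx.
have Llin : linear L.
  move=> a x y; apply: (@cvg_lim _ (@norm_hausdorff _ W)).
  have -> : (fun f : bop Z W => f (a *: x + y)) = (fun f : bop Z W => a *: f x + f y).
    by apply/funext => f; rewrite linearP.
  by apply: cvgD; [apply: cvgZl_tmp; exact: FL|exact: FL].
have Lle (e : R) : 0 < e -> exists2 S : set (bop Z W), F S &
    forall f x, S f -> rnorm (f x - L x) <= e * rnorm x.
  move=> /Fc_le[S FS SP]; exists S => // f x Sf; apply/ler_addgt0Pr => d d0.
  have d0' : 0 < d%:C by rewrite ltcR.
  have /cvgrPdist_lt /(_ _ d0') Ld := FL x.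
  have [g [Sg]] := filter_ex (filterI FS Ld).
  rewrite /= rnormE ltcR => Lg.
  have -> : f x - L x = (f x - g x) + - (L x - g x) by rewrite opprB addrA subrK.
  rewrite (le_trans (rnormD _ _))// lerD ?SP//.
  by rewrite /rnorm normrN; exact: ltW.
have Lbdd : L \in @bounded_operator R Z W.
  apply/bounded_operatorP; split => //.
  have [S FS SP] := Lle 1 ltr01; have [f Sf] := filter_ex FS.
  exists (opnorm f + 1) => x.
  have -> : L x = f x + - (f x - L x) by rewrite opprB addrC subrK.
  rewrite (le_trans (rnormD _ _))// mulrDl lerD ?opnorm_le//.
  by rewrite /rnorm normrN; exact: SP.
apply/cvg_ex; exists (Bop Lbdd); apply/cvgrPdist_le => _ /gt0_complexE[e e0 ->].
have [S FS SP] := Lle e e0; apply: filterS FS => f Sf.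
rewrite distrC rnormE lecR; apply: opnorm_le_bound; first exact: ltW.
by move=> x; exact: SP.
Qed.

HB.instance Definition _ := Uniform_isComplete.Build (bop Z W) bop_complete.
End bop_complete.

Section duality.
Variable R : realType.

Definition dual (Z : normedModType R[i]) : completeNormedModType R[i] :=
  bop Z R[i].

Section adjoint.
Variables Z W : normedModType R[i].

Lemma comp_bounded_operator (V : normedModType R[i])
  (S : bop W V) (T : bop Z W) : (S \o T) \in @bounded_operator R Z V.
Proof.
apply/bounded_operatorP; split; first by move=> a x y /=; rewrite !linearP.
exists (opnorm S * opnorm T) => x /=; rewrite -mulrA.
by rewrite (le_trans (opnorm_le _ _))// ler_wpM2l ?opnorm_ge0 ?opnorm_le.
Qed.

Definition bop_comp (V : normedModType R[i]) (S : bop W V) (T : bop Z W) :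
  bop Z V := Bop (comp_bounded_operator S T).

Lemma adjoint_bounded_operator (T : bop Z W) :
  ((fun g => bop_comp g T) : dual W -> dual Z) \in
    @bounded_operator R (dual W) (dual Z).
Proof.
apply/bounded_operatorP; split; first by move=> a f g; apply/bopP.
exists (opnorm T) => g; rewrite !rnorm_bop.
apply: opnorm_le_bound; first by rewrite mulr_ge0 ?opnorm_ge0.
move=> x; rewrite [opnorm T * _]mulrC -mulrA (le_trans (opnorm_le g (T x)))//.
by rewrite ler_wpM2l ?opnorm_ge0 ?opnorm_le.
Qed.

Definition adjoint (T : bop Z W) : bop (dual W) (dual Z) :=
  Bop (adjoint_bounded_operator T).

Lemma adjointE (T : bop Z W) (g : dual W) (x : Z) : adjoint T g x = g (T x).
Proof. by []. Qed.

End adjoint.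

Section reflexive.
Variable Z : normedModType R[i].

Lemma eval_bounded_operator (x : Z) :
  ((fun f => f x) : dual Z -> R[i]) \in @bounded_operator R (dual Z) R[i].
Proof.
apply/bounded_operatorP; split=> //; exists (rnorm x) => f.
by rewrite mulrC opnorm_le.
Qed.

Definition bidual_map (x : Z) : dual (dual Z) := Bop (eval_bounded_operator x).

Definition reflexive_space : Prop :=
  forall F : dual (dual Z), exists x : Z, bidual_map x = F.

End reflexive.

End duality.

(* G is an rg-Riesz basis for Z^* with respect to the spaces W i (the index set
   {1, 2, ...} is renumbered as nat).  Values of g outside I1 play no role. *)
Definition g_Riesz_basis (R : realType) (r : R) (Z : completeNormedModType R[i])
    (W : nat -> completeNormedModType R[i]) (G : forall i, bop Z (W i)) : Prop :=
  (forall f : Z, (forall i, G i f = 0) -> f = 0) /\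
  exists A B : R, [/\ 0 < A, 0 < B &
    forall (I1 : {fset nat}) (g : forall i, dual (W i)),
      let N := (\sum_(i <- I1) rnorm (g i) `^ r) `^ r^-1 in
      A * N <= rnorm (\sum_(i <- I1) adjoint (G i) (g i)) <= B * N].

Section multiplier.
Variables (R : realType) (X1 X2 : completeNormedModType R[i]).
Variables (Y : nat -> completeNormedModType R[i]) (m : nat -> R[i]).
Variables (L : forall i, bop X2 (Y i)) (T : forall i, bop (dual X1) (dual (Y i))).

Definition multiplier_term (g : dual X1) (i : nat) : dual X2 :=
  m i *: adjoint (L i) (T i g).

Definition multiplier (g : dual X1) : dual X2 :=
  limn (series (multiplier_term g)).

End multiplier.

Definition invertible_operator (R : realType) (X Y : normedModType R[i])
    (T : X -> Y) : Prop :=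
  T \in @bounded_operator R X Y /\
  exists S : Y -> X, [/\ cancel T S, cancel S T & S \in @bounded_operator R Y X].

(* Main.v *)
(* Let r and s be conjugate exponents.  For an rg-Riesz basis (G_i), the lower
   bound and Hoelder's inequality control sum_i F_i (h_i) by the norm of
   sum_i G_i^* F_i, and the Hahn-Banach theorem extends this assignment to an
   element of Z^**; by reflexivity the system G_i z = h_i is thus solvable with
   norm control for every s-summable h.  For Theta and h_i = Theta_i g, condition
   (i) forces the solution to be g itself, so the analysis operator of Theta,
   hence the multiplier, is bounded below and has closed range.  For sequences h
   supported at one index, the solutions put every Lambda_j^* y in the range,
   which is therefore dense, again by Hahn-Banach and condition (i) for Lambda. *)
From HB Require Import structures.
Require Import Defs.
From mathcomp Require Import all_boot all_order all_algebra.
From mathcomp Require Import finmap complex.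
From mathcomp Require Import all_classical all_reals all_analysis.
From mathcomp Require Import lra.
Import Order.TTheory GRing.Theory Num.Theory.
Import numFieldNormedType.Exports.

Set Implicit Arguments.
Unset Strict Implicit.

Local Open Scope classical_set_scope.
Local Open Scope ring_scope.
Local Open Scope complex_scope.

(* The graph of a linear map on a subspace; single-valuedness is not imposed, as
   it follows from every norm bound. *)
Definition linear_relation {K : nzRingType} {U W : lmodType K}
    (G : set (U * W)) : Prop :=
  G !=set0 /\ forall a x y, G x -> G y -> G (a *: x + y).

Lemma linear_relation0 {K : nzRingType} {U W : lmodType K} {G : set (U * W)} :
  linear_relation G -> G 0.
Proof.
move=> [[x Gx] Glin]; have := Glin (-1) x x Gx Gx.
by rewrite scaleN1r addNr.
Qed.

(** * Real Hahn-Banach theorem with a sublinear bound *)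

Section hahn_banach.
Variables (R : realType) (V : lmodType R) (p : V -> R).
Hypothesis pZ : forall (a : R) v, 0 <= a -> p (a *: v) = a * p v.
Hypothesis pD : forall u v, p (u + v) <= p u + p v.
Implicit Types G H : set (V * R^o).

Let dominated H := forall x, H x -> x.2 <= p x.1.

Let p0 : p 0 = 0.
Proof. by rewrite -(scale0r 0) pZ// mul0r. Qed.

Let functional H v c d : linear_relation H -> dominated H ->
  H (v, c) -> H (v, d) -> c = d.
Proof.
move=> [_ Hlin] Hp Hc Hd; apply/eqP; rewrite eq_le.
have H1 := Hp _ (Hlin (-1) _ _ Hc Hd); have H2 := Hp _ (Hlin (-1) _ _ Hd Hc).
move: H1 H2; rewrite /= !scaleN1r !addNr p0.
by rewrite ![- _ + _]addrC !subr_le0 => -> ->.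
Qed.

(** The span of [H] and [(v, c)]: the graph of the extension that sends [v] to [c]. *)
Definition adjoin H (v : V) (c : R) : set (V * R^o) :=
  [set x | exists t : R, H (x - t *: ((v, c) : V * R^o))].

Let adjoin_linear H v c : linear_relation H ->
  linear_relation (adjoin H v c).
Proof.
move=> HL; have H0 := linear_relation0 HL; have [_ Hlin] := HL; split.
  by exists 0, 0; rewrite scale0r subr0.
move=> a x y [s Hs] [t Ht]; exists (a * s + t).
have := Hlin a _ _ Hs Ht.
by rewrite scalerBr scalerA scalerDl opprD addrACA.
Qed.

(** The value [c] must lie above every [x.2 - p (x.1 - v)] and below every [p (y.1 + v) - y.2].
    Subadditivity puts the first family below the second, so the supremum of the first serves;
    positive homogeneity reduces all multiples of [v] to these two cases. *)
Let adjoin_dominated H v : linear_relation H -> dominated H ->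
  exists c, dominated (adjoin H v c).
Proof.
move=> HL Hp; have H0 := linear_relation0 HL; have [_ Hlin] := HL.
have Hsub x : H x -> forall a : R, H (a *: x).
  by move=> Hx a; rewrite -[_ *: _]addr0; apply: Hlin.
pose S := [set x.2 - p (x.1 - v) | x in H].
have Sub y : H y -> ubound S (p (y.1 + v) - y.2).
  move=> Hy _ [x Hx <-]; rewrite lerBlDr addrAC lerBrDr.
  have /= := Hp _ (Hlin 1 _ _ Hx Hy); rewrite !scale1r => /le_trans; apply.
  rewrite [leLHS](_ : _ = p ((y.1 + v) + (x.1 - v))) ?pD//.
  by rewrite addrACA subrr addr0 addrC.
have S0 : S !=set0 by exists (0 - p (0 - v)), 0.
have S_sup : has_sup S.
  by split => //; exists (p (0 + v) - 0); exact: (Sub _ H0).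
have supS x : H x -> x.2 - p (x.1 - v) <= sup S.
  by move=> Hx; apply: ub_le_sup; [case: S_sup|exists x].
have Ssup y : H y -> sup S <= p (y.1 + v) - y.2.
  by move=> Hy; apply: ge_sup => //; exact: Sub.
have up (s : R) y : 0 < s -> H y -> s * sup S <= p (y.1 + s *: v) - y.2.
  move=> s0 Hy; have sV : s * s^-1 = 1 by rewrite divff// gt_eqF.
  have : sup S <= p (s^-1 *: y.1 + v) - s^-1 * y.2.
    exact: (Ssup _ (Hsub _ Hy s^-1)).
  by rewrite -(ler_pM2l s0) mulrBr -pZ ?(ltW s0)// scalerDr scalerA mulrA
    sV scale1r mul1r.
have dn (s : R) y : 0 < s -> H y -> y.2 - p (y.1 - s *: v) <= s * sup S.
  move=> s0 Hy; have sV : s * s^-1 = 1 by rewrite divff// gt_eqF.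
  have : s^-1 * y.2 - p (s^-1 *: y.1 - v) <= sup S.
    exact: (supS _ (Hsub _ Hy s^-1)).
  by rewrite -(ler_pM2l s0) mulrBr -pZ ?(ltW s0)// scalerBr scalerA mulrA
    sV scale1r mul1r.
exists (sup S) => x [t Ht].
have [t0|t0|t0] := ltgtP t 0.
- have nt0 : 0 < - t by rewrite oppr_gt0.
  have /= := dn _ _ nt0 Ht.
  rewrite scaleNr opprK subrK mulNr /GRing.scale /=.
  lra.
- have /= := up _ _ t0 Ht.
  rewrite subrK /GRing.scale /=; lra.
- by move: Ht; rewrite t0 scale0r subr0 => /Hp.
Qed.

(** Zorn's lemma on the sets [H] whose union with [G] is a dominated linear relation; taking the
    union with [G] makes the empty chain admissible. *)
Theorem hahn_banach_real G : linear_relation G ->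
    (forall x, G x -> x.2 <= p x.1) ->
  exists f : V -> R, [/\ linear (f : V -> R^o), forall x, G x -> f x.1 = x.2 &
    forall v, f v <= p v].
Proof.
move=> GL Gp.
pose P H := linear_relation (H `|` G) /\ dominated (H `|` G).
have [|A [[AL Ap] Amax]] := @Zorn_bigcup _ P.
  move=> F FP Ftot.
  (* Members of a chain are comparable, so two points of the union already lie in a single member
     enlarged by [G], or both in [G]. *)
  have two x y : (\bigcup_(X in F) X `|` G) x -> (\bigcup_(X in F) X `|` G) y ->
      (G x /\ G y) \/ exists2 X, F X & (X `|` G) x /\ (X `|` G) y.
    move=> [[X FX Xx]|Gx] [[Y FY Yy]|Gy]; last by left.
    - right; have [XY|YX] := Ftot _ _ FX FY.
      + by exists Y => //; split; left => //; exact: XY.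
      + by exists X => //; split; left => //; exact: YX.
    - by right; exists X => //; split; [left|right].
    - by right; exists Y => //; split; [right|left].
  split.
    split; first by exists 0; right; exact: linear_relation0.
    move=> a x y Hx Hy; have [[Gx Gy]|[X FX [Xx Xy]]] := two _ _ Hx Hy.
      by right; apply: (proj2 GL).
    have [[_ Xlin] _] := FP _ FX.
    by have [?|?] := Xlin a _ _ Xx Xy; [left; exists X|right].
  move=> x [[X FX Xx]|Gx]; last exact: Gp.
  by apply: (proj2 (FP _ FX)); left.
(* A vector outside the domain of the maximal relation could be adjoined, against maximality. *)
have dom v : exists c, (A `|` G) (v, c).
  apply: contrapT => nv.
  have [c Bp] := adjoin_dominated v AL Ap.
  have BL := adjoin_linear v c AL.
  have AB : A `|` G `<=` adjoin (A `|` G) v c.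
    by move=> x Hx; exists 0; rewrite scale0r subr0.
  have BG : adjoin (A `|` G) v c `|` G = adjoin (A `|` G) v c.
    by apply/setUidPl => x Gx; apply: AB; right.
  apply: (Amax (adjoin (A `|` G) v c)); last by rewrite /P BG.
  split; first by move=> x Ax; apply: AB; left.
  move=> BA; apply: nv; exists c; left; apply: BA; exists 1.
  by rewrite scale1r subrr; exact: linear_relation0.
exists (fun v => projT1 (cid (dom v))); split.
- move=> a u v; case: cid => w /= Hw; case: cid => c /= Hc.
  case: cid => d /= Hd.
  exact: (functional AL Ap Hw (proj2 AL a _ _ Hc Hd)).
- move=> [v c] Gx /=; case: cid => d /= Hd.
  by apply: (functional AL Ap Hd); right.
- by move=> v; case: cid => c /= /Ap.
Qed.

End hahn_banach.

(** * Complex Hahn-Banach theorem *)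

Definition realified (R : realType) (V : lmodType R[i]) : Type := V.

Section realified.
Variables (R : realType) (V : lmodType R[i]).

HB.instance Definition _ := GRing.Zmodule.copy (realified V) V.

(** The alias [realified V] keeps this real action apart from the complex one carried by [V]. *)
Definition realified_scale (a : R) (v : realified V) : realified V :=
  (a%:C : R[i]) *: (v : V).

Let scaleA a b v :
  realified_scale a (realified_scale b v) = realified_scale (a * b) v.
Proof. by rewrite /realified_scale scalerA rmorphM. Qed.

Let scale1 : left_id 1 realified_scale.
Proof. by move=> v; rewrite /realified_scale rmorph1 scale1r. Qed.

Let scaleDr : right_distributive realified_scale +%R.
Proof. by move=> a u v; rewrite /realified_scale scalerDr. Qed.

Let scaleDl v : {morph realified_scale^~ v : a b / a + b}.
Proof. by move=> a b; rewrite /realified_scale rmorphD scalerDl. Qed.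

HB.instance Definition _ := GRing.Zmodule_isLmodule.Build R (realified V)
  scaleA scale1 scaleDr scaleDl.

End realified.

Section complex_hahn_banach.
Variables (R : realType) (V : normedModType R[i]).

Lemma rnorm_real (a : R) : rnorm (a%:C : R[i]) = `|a|.
Proof. by rewrite rnorm_complexE /= expr0n addr0 sqrtr_sqr. Qed.

Lemma rnorm_complexJ (z : R[i]) : rnorm (z^* : R[i]) = rnorm z.
Proof. by rewrite /rnorm normcJ. Qed.

(** The real part of [G] extends to a real functional [psi], and [psi v - i psi (i v)] is the
    complex functional with real part [psi]. *)
Theorem hahn_banach (C : R) (G : set (V * R[i])) : 0 <= C ->
    linear_relation G -> (forall x, G x -> rnorm x.2 <= C * rnorm x.1) ->
  exists2 f : dual V, opnorm f <= C & forall x, G x -> f x.1 = x.2.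
Proof.
move=> C0 GL GC.
pose GR : set (realified V * R^o) := [set (x.1, complex.Re x.2) | x in G].
have GRL : linear_relation GR.
  split; first by exists (0, 0), 0 => //; exact: linear_relation0.
  move=> a _ _ [x Gx <-] [y Gy <-]; exists (a%:C *: x + y).
    exact: (proj2 GL).
  congr (_, _); case: x y {Gx Gy} => [u [c d]] [v [c' d']] /=.
  by rewrite /GRing.scale /= mul0r subr0.
have [||//|phi [phiL phiG phiC]] :=
    @hahn_banach_real R (realified V) (fun v => C * rnorm (v : V)) _ _ GR GRL.
- by move=> a v a0; rewrite rnormZ rnorm_real ger0_norm// mulrCA.
- by move=> u v; rewrite -mulrDr ler_wpM2l// rnormD.
- move=> _ [x Gx <-] /=; apply: le_trans (GC _ Gx).
  exact: le_trans (ler_norm _) (Re_le_rnorm _).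
pose psi : V -> R := phi.
have psiD (u v : V) : psi (u + v) = psi u + psi v.
  by have := phiL 1 u v; rewrite !scale1r.
have psi0 : psi 0 = 0 by apply: (addrI (psi 0)); rewrite -psiD !addr0.
have psiZ (a : R) (v : V) : psi ((a%:C : R[i]) *: v) = a * psi v.
  by have := phiL a v 0; rewrite [phi 0]psi0 !addr0.
pose i : R[i] := 0 +i* 1.
have psiZC (a : R[i]) (v : V) :
    psi (a *: v) = complex.Re a * psi v + complex.Im a * psi (i *: v).
  rewrite -!psiZ -psiD [X in _ = psi (_ + X)]scalerA -scalerDl.
  by case: a => a b; congr (psi (_ *: v)); rewrite /i; simpc.
pose f v : R[i] := psi v -i* psi (i *: v).
have fL : linear (f : V -> R[i]).
  move=> a u v; rewrite /f scalerDr !psiD scalerA (psiZC a u) (psiZC (i * a) u).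
  case: a => a b; rewrite /i; simpc; congr (_ +i* _) => /=; lra.
have fC v : rnorm (f v) <= C * rnorm v.
  have [->|n0] := eqVneq (rnorm (f v)) 0; first by rewrite mulr_ge0 ?rnorm_ge0.
  have nf : 0 < rnorm (f v) by rewrite lt_neqAle eq_sym n0 rnorm_ge0.
  (* Rotation without division: at the conjugate of [f v] times [v], the real functional [psi] takes
     the value [rnorm (f v) ^+ 2], and the real bound applies there. *)
  rewrite -(ler_pM2l nf).
  have -> : rnorm (f v) * rnorm (f v) = psi ((f v)^* *: v).
    rewrite psiZC rnorm_complexE -[LHS]expr2 sqr_sqrtr ?addr_ge0 ?sqr_ge0//=.
    lra.
  by apply: le_trans (phiC _) _; rewrite rnormZ rnorm_complexJ mulrCA.
have fB : (f : V -> R[i]) \in @bounded_operator R V R[i].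
  by apply/bounded_operatorP; split => //; exists C.
exists (Bop fB); first exact: opnorm_le_bound.
move=> x Gx /=.
have re y : G y -> psi y.1 = complex.Re y.2.
  by move=> Gy; apply: (phiG (y.1, complex.Re y.2)); exists y.
(* [G] is stable under multiplication by [i], so the real part of its value at [i *: x] recovers the
   imaginary part of [x.2]. *)
have Gix : G (i *: x).
  by rewrite -[_ *: _]addr0; apply: (proj2 GL) => //; exact: linear_relation0.
rewrite /f (re _ Gx) (re _ Gix) {re Gix} /=; case: x {Gx} => v [a b].
by rewrite /i /GRing.scale /=; simpc.
Qed.

End complex_hahn_banach.

(** * Hölder's inequality for finite sums *)

Lemma hoelder_sum (R : realType) (I : Type) (s : seq I) (a b : I -> R)
    (p q : R) :
  0 < p -> 0 < q -> p^-1 + q^-1 = 1 ->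
  (forall i, 0 <= a i) -> (forall i, 0 <= b i) ->
  \sum_(i <- s) a i * b i <=
    (\sum_(i <- s) a i `^ p) `^ p^-1 * (\sum_(i <- s) b i `^ q) `^ q^-1.
Proof.
move=> p0 q0 pq a0 b0.
have S0 (c : I -> R) (r : R) t : 0 <= \sum_(i <- t) c i `^ r.
  by apply: sumr_ge0 => i _; exact: powR_ge0.
have SK (c : I -> R) (r : R) t : 0 < r ->
    ((\sum_(i <- t) c i `^ r) `^ r^-1) `^ r = \sum_(i <- t) c i `^ r.
  by move=> r0; rewrite -powRrM mulVf ?gt_eqF// powRr1.
elim: s => [|x s IH]; first by rewrite big_nil mulr_ge0// powR_ge0.
rewrite !big_cons; apply: le_trans (_ : _ <= a x * b x + _) _.
  by rewrite lerD2l; exact: IH.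
(* Each tail sum becomes a power of the norm of the tail, so the two-term inequality applies to the
   head and the tail norm. *)
rewrite -[in leRHS](SK a p s p0) -[in leRHS](SK b q s q0).
by apply: hoelder2; rewrite ?powR_ge0.
Qed.

(** * Norming functionals and reflexivity *)

Section functionals.
Variables (R : realType) (V : normedModType R[i]).

(** Extends [c *: v |-> c * rnorm v] from the line through [v], with bound 1. *)
Lemma norming_functional (v : V) :
  exists2 f : dual V, opnorm f <= 1 & f v = (rnorm v)%:C.
Proof.
pose G := [set x : V * R[i] | exists c : R[i], x = (c *: v, c * (rnorm v)%:C)].
have [|||f f1 fG] := @hahn_banach R V 1 G.
- exact: ler01.
- split; first by exists 0, 0; rewrite scale0r mul0r.
  move=> a _ _ [c ->] [d ->]; exists (a * c + d).
  by rewrite scalerDl mulrDl -scalerA -mulrA.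
- move=> _ [c ->] /=; rewrite mul1r [rnorm (c * _)](rnormZ c) rnormZ.
  by rewrite rnorm_real ger0_norm ?rnorm_ge0.
exists f => //; rewrite -[v in LHS]scale1r -[RHS]mul1r.
by apply: (fG (1 *: v, 1 * (rnorm v)%:C)); exists 1.
Qed.

Lemma dual_separates (v w : V) : (forall f : dual V, f v = f w) -> v = w.
Proof.
move=> vw; have [f _] := norming_functional (v - w).
rewrite linearB /= vw subrr => /esym/complexI/rnorm0_eq0.
by move/eqP; rewrite subr_eq0 => /eqP.
Qed.

Lemma rnorm_bidual_map (v : V) : rnorm (bidual_map v) = rnorm v.
Proof.
apply/eqP; rewrite eq_le rnorm_bop opnorm_le_bound ?rnorm_ge0//=; last first.
  by move=> f; rewrite mulrC opnorm_le.
have [f f1 fv] := norming_functional v.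
have := opnorm_le (bidual_map v) f.
rewrite /= fv rnorm_real ger0_norm ?rnorm_ge0// => /le_trans; apply.
by rewrite ler_piMr ?opnorm_ge0// rnorm_bop.
Qed.

Lemma bidual_map_linear : linear (bidual_map (Z := V)).
Proof. by move=> a u v; apply/bopP => f /=; rewrite linearP. Qed.

(** [F] composed with the canonical map is a functional on [V]. Every [phi] in the bidual is
    evaluation at some [v], so [F] agrees everywhere with evaluation at that functional. *)
Lemma dual_reflexive : reflexive_space V -> reflexive_space (dual V).
Proof.
move=> VR F.
have gB : (fun v => F (bidual_map v)) \in @bounded_operator R V R[i].
  apply/bounded_operatorP; split.
    by move=> a u v; rewrite bidual_map_linear linearP.
  by exists (opnorm F) => v; rewrite -rnorm_bidual_map opnorm_le.
by exists (Bop gB); apply/bopP => phi; have [v <-] := VR phi.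
Qed.

End functionals.

(** * Finite [r]-norms *)

Section seq_norm.
Variables (R : realType) (I : Type).
Implicit Types (r : R) (s : seq I) (a b : I -> R).

Definition seq_norm r s a : R := (\sum_(i <- s) a i `^ r) `^ r^-1.

Lemma sum_powR_ge0 r s a : 0 <= \sum_(i <- s) a i `^ r.
Proof. by apply: sumr_ge0 => i _; exact: powR_ge0. Qed.

Lemma seq_norm_ge0 r s a : 0 <= seq_norm r s a.
Proof. exact: powR_ge0. Qed.

Lemma le_seq_norm r s a b : 0 < r -> (forall i, 0 <= a i) ->
  (forall i, a i <= b i) -> seq_norm r s a <= seq_norm r s b.
Proof.
move=> r0 a0 ab; rewrite /seq_norm ge0_ler_powR ?nnegrE ?sum_powR_ge0//.
  by rewrite invr_ge0 ltW.
apply: ler_sum => i _; rewrite ge0_ler_powR ?nnegrE ?a0 ?(ltW r0)//.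
exact: le_trans (a0 i) (ab i).
Qed.

Lemma seq_normZ r s a (c : R) : 0 < r -> 0 <= c -> (forall i, 0 <= a i) ->
  seq_norm r s (fun i => c * a i) = c * seq_norm r s a.
Proof.
move=> r0 c0 a0; rewrite /seq_norm.
under eq_bigr do rewrite powRM//.
rewrite -mulr_sumr powRM ?powR_ge0 ?sum_powR_ge0//.
by rewrite -powRrM mulfV ?gt_eqF// powRr1.
Qed.

End seq_norm.

(** * Analysis bound and moment problem for a g-Riesz basis *)

Section riesz.
Variables (R : realType) (r s : R) (r0 : 0 < r) (s0 : 0 < s).
Hypothesis rs : r^-1 + s^-1 = 1.
Variables (Z : completeNormedModType R[i]).
Variables (W : nat -> completeNormedModType R[i]).
Variable G : forall i, bop Z (W i).

Definition synthesis (t : seq nat) (F : forall i, dual (W i)) : dual Z :=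
  \sum_(i <- t) adjoint (G i) (F i).

Lemma synthesisE t F z : synthesis t F z = \sum_(i <- t) F i (G i z).
Proof.
rewrite /synthesis; elim: t => [|i t IH]; first by rewrite !big_nil.
by rewrite !big_cons bopD IH.
Qed.

Lemma synthesis_linear t a F F' :
  synthesis t (fun i => a *: F i + F' i) = a *: synthesis t F + synthesis t F'.
Proof.
apply/bopP => z; rewrite bopD bopZ !synthesisE scaler_sumr -big_split /=.
by apply: eq_bigr.
Qed.

(** Passing from finite sets to duplicate-free lists makes the bounds available on the initial
    segments [index_iota 0 n]. *)
Lemma g_Riesz_basis_seq : g_Riesz_basis r G ->
  exists A B : R, [/\ 0 < A, 0 < B &
  forall t (F : forall i, dual (W i)), uniq t ->
    A * seq_norm r t (fun i => rnorm (F i)) <= rnorm (synthesis t F) <=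
    B * seq_norm r t (fun i => rnorm (F i))].
Proof.
move=> [_ [A [B [A0 B0 AB]]]]; exists A, B; split => // t F ut.
have tt : perm_eq [fset x in t]%fset t.
  by apply: uniq_perm => // x; rewrite inE.
have := AB [fset x in t]%fset F.
by rewrite /= !(perm_big _ tt).
Qed.

(** By duality: take [F i] norming [G i z], scaled to size [rnorm (G i z) ^ (s - 1)]. The synthesis
    of [F] at [z] is the sum [S] of the [s]-th powers, while [F] has [r]-norm at most [S ^ (1/r)];
    cancelling this factor leaves [S ^ (1/s)]. *)
Lemma analysis_le (B : R) : 0 <= B ->
    (forall t F, uniq t ->
      rnorm (synthesis t F) <= B * seq_norm r t (fun i => rnorm (F i))) ->
  forall t z, uniq t -> seq_norm s t (fun i => rnorm (G i z)) <= B * rnorm z.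
Proof.
move=> B0 HB t z ut.
have [F Fz FN] : exists2 F : forall i, dual (W i),
    (forall i, F i (G i z) = (rnorm (G i z) `^ s)%:C) &
    forall i, rnorm (F i) <= rnorm (G i z) `^ (s - 1).
  have /all_sig2[f f1 fz] i := cid2 (norming_functional (G i z)).
  exists (fun i => ((rnorm (G i z) `^ (s - 1))%:C : R[i]) *: f i) => i.
    by rewrite bopZ fz -[LHS]rmorphM /= mulrC mulr_powRB1 ?rnorm_ge0.
  rewrite rnormZ rnorm_real ger0_norm ?powR_ge0// ler_piMr ?powR_ge0//.
  exact: f1.
pose S := \sum_(i <- t) rnorm (G i z) `^ s.
have S0 : 0 <= S by exact: sum_powR_ge0.
have FS : synthesis t F z = S%:C.
  by rewrite synthesisE rmorph_sum; apply: eq_bigr => i _; rewrite Fz.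
have {}FN : seq_norm r t (fun i => rnorm (F i)) <= S `^ r^-1.
  have -> : S `^ r^-1 = seq_norm r t (fun i => rnorm (G i z) `^ (s - 1)).
    congr (_ `^ _); apply: eq_bigr => i _; rewrite -powRrM; congr (_ `^ _).
    (* Conjugacy multiplied by [r * s] gives [(s - 1) * r = s]. *)
    have /(congr1 ( *%R (r * s))) := rs.
    rewrite mulr1 mulrDr mulrAC divff ?gt_eqF// mul1r -mulrA divff ?gt_eqF//.
    lra.
  by apply: le_seq_norm => // i; exact: rnorm_ge0.
have : S <= B * S `^ r^-1 * rnorm z.
  have SE : S = rnorm (synthesis t F z : R[i]).
    by rewrite FS rnorm_real ger0_norm.
  rewrite [X in X <= _]SE; apply: le_trans (opnorm_le _ _) _.
  apply: ler_wpM2r; first exact: rnorm_ge0.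
  apply: le_trans (HB _ _ ut) _.
  exact: ler_wpM2l.
have [S00 _|Sn0] := eqVneq S 0.
  rewrite /seq_norm -/S S00 powR0; last by rewrite invr_eq0 gt_eqF.
  by rewrite mulr_ge0 ?rnorm_ge0.
have Sp : 0 < S by rewrite lt_neqAle eq_sym Sn0.
rewrite -{1}(powRr1 S0) -rs powRD; last by rewrite Sn0 implybT.
by rewrite mulrAC [leRHS]mulrC ler_pM2l// powR_gt0.
Qed.

(** A Helly-type argument: in the bound of the functional sending syntheses to moments, Hölder
    contributes [K] and the lower Riesz bound contributes [1 / A]. *)
Lemma moment_problem (A K : R) (h : forall i, W i) : 0 < A ->
    reflexive_space Z ->
    (forall t F, uniq t ->
      A * seq_norm r t (fun i => rnorm (F i)) <= rnorm (synthesis t F)) ->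
    (forall n, seq_norm s (index_iota 0 n) (fun i => rnorm (h i)) <= K) ->
  exists2 z, forall i, G i z = h i & rnorm z <= K / A.
Proof.
move=> A0 Zrefl HA hK.
have K0 : 0 <= K by apply: le_trans (hK 0%N); exact: seq_norm_ge0.
pose moments (F : forall i, dual (W i)) n : R[i] :=
  \sum_(i <- index_iota 0 n) F i (h i).
(* Finite families are encoded by partial sums that are constant from some [n0] on, so two of them
   combine beyond the larger threshold. *)
pose Rel := [set x : dual Z * R[i] | exists F n0, forall n, (n0 <= n)%N ->
  x = (synthesis (index_iota 0 n) F, moments F n)].
have [|||phi phiK phiRel] := @hahn_banach R (dual Z) (K / A) Rel.
- by rewrite divr_ge0// ltW.
- split.
    exists 0, (fun=> 0), 0%N => n _; congr (_, _).
    + by rewrite /synthesis big1// => i _; rewrite linear0.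
    + by rewrite /moments big1.
  move=> a x y [F [n xn]] [F' [n' xn']].
  exists (fun i => a *: F i + F' i), (maxn n n') => k.
  rewrite geq_max => /andP[nk n'k]; rewrite (xn k)// (xn' k)//; congr (_, _).
  + by rewrite synthesis_linear.
  + rewrite /moments /= [_ *: _]mulr_sumr -big_split /=.
    by apply: eq_bigr.
- move=> _ [F [n /(_ n (leqnn n)) ->]] /=.
  have : rnorm (moments F n) <=
      seq_norm r (index_iota 0 n) (fun i => rnorm (F i)) * K.
    apply: (@le_trans _ _ (\sum_(i <- index_iota 0 n)
      rnorm (F i) * rnorm (h i))).
      rewrite /moments; elim: (index_iota 0 n) => [|i l IH].
        by rewrite !big_nil rnorm0.
      rewrite !big_cons; apply: le_trans (rnormD _ _) _.
      by apply: lerD => //; exact: opnorm_le.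
    apply: le_trans (hoelder_sum _ r0 s0 rs _ _) _.
    - by move=> i; exact: rnorm_ge0.
    - by move=> i; exact: rnorm_ge0.
    by rewrite ler_wpM2l ?powR_ge0//; exact: hK.
  move=> /le_trans; apply; rewrite [K / A]mulrC mulrAC ler_wpM2r//.
  by rewrite ler_pdivlMl//; apply: HA; exact: iota_uniq.
have [z zphi] := Zrefl phi.
exists z; last by rewrite -rnorm_bidual_map zphi rnorm_bop.
move=> i; apply: dual_separates => f.
have := phiRel (adjoint (G i) f, f (h i)); rewrite -zphi /=; apply.
(* The family is [f] at [i] and zero elsewhere; the index [i] enters [index_iota 0 n] from
   [n = i.+1] on. *)
exists (@dfwith nat (fun j => dual (W j)) (fun=> 0) i f), i.+1 => n ltin.
have un : uniq (index_iota 0 n) by exact: iota_uniq.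
have iin : i \in index_iota 0 n by rewrite mem_index_iota.
congr (_, _).
- rewrite /synthesis (bigD1_seq i)//= dfwithin big1 ?addr0// => j ji.
  by rewrite dfwithout 1?eq_sym//; apply/bopP.
- rewrite /moments (bigD1_seq i)//= dfwithin big1 ?addr0// => j ji.
  by rewrite dfwithout 1?eq_sym.
Qed.

End riesz.

(** * Norm bounds under limits *)

Section limits.
Variables (R : realType) (V : normedModType R[i]).

Lemma cvg_rnorm_close (u : nat -> V) (l : V) (e : R) : u @ \oo --> l -> 0 < e ->
  \forall n \near \oo, rnorm (l - u n) < e.
Proof.
move=> ul e0; have e0' : 0 < e%:C by rewrite ltcR.
move/cvgrPdist_lt : ul => /(_ _ e0'); apply: filterS => n.
by rewrite rnormE ltcR.
Qed.

Lemma rnormB (x y : V) : rnorm (x - y) = rnorm (y - x).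
Proof. by rewrite /rnorm distrC. Qed.

Lemma rnorm_lim_le (u : nat -> V) (l : V) (b : R) : u @ \oo --> l ->
  (forall n, rnorm (u n) <= b) -> rnorm l <= b.
Proof.
move=> ul ub; apply/ler_addgt0Pr => e e0.
have [n nl] := filter_ex (cvg_rnorm_close ul e0).
rewrite -[l](subrK (u n)) addrC [leRHS]addrC; apply: le_trans (rnormD _ _) _.
by rewrite [leRHS]addrC lerD// ltW.
Qed.

Lemma le_rnorm_lim (u : nat -> V) (l : V) (a : R) N : u @ \oo --> l ->
  (forall n, (N <= n)%N -> a <= rnorm (u n)) -> a <= rnorm l.
Proof.
move=> ul au; apply/ler_addgt0Pr => e e0.
have [n [nl Nn]] :=
  filter_ex (filterI (cvg_rnorm_close ul e0) (nbhs_infty_ge N)).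
apply: le_trans (au n Nn) _; rewrite -[u n](subrK l) addrC.
by apply: le_trans (rnormD _ _) _; rewrite lerD2l rnormB ltW.
Qed.

End limits.

(** * Surjectivity from a lower bound and a dense range *)

Section dense_range.
Variables (R : realType) (U V : completeNormedModType R[i]).

(** Hahn-Banach gives density of the range; the lower bound makes preimages of a convergent sequence
    Cauchy, so their limit is a preimage of [y]. *)
Lemma bounded_below_surj (f : bop U V) (a : R) : 0 < a ->
    (forall x, a * rnorm x <= rnorm (f x)) ->
    (forall phi : dual V, (forall x, phi (f x) = 0) -> phi = 0) ->
  forall y, exists x, f x = y.
Proof.
move=> a0 fa fdense y.
have close (e : R) : 0 < e -> exists x, rnorm (y - f x) < e.
  move=> e0; apply: contrapT => ny.
  have ye x : e <= rnorm (y - f x).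
    by rewrite leNgt; apply/negP => yx; apply: ny; exists x.
  (* This functional vanishes on the range and is 1 at [y]. Scaling [c] out of [c *: y - f x] bounds
     it by [e^-1], since [y] stays at distance at least [e] from the range. *)
  pose Rel := [set z : V * R[i] | exists c x, z = (c *: y - f x, c)].
  have [|||phi _ phiRel] := @hahn_banach R V e^-1 Rel.
  - by rewrite invr_ge0 ltW.
  - split.
      by exists (0 - f 0, 0), 0, 0; rewrite scale0r.
    move=> b z z' [c [x ->]] [c' [x' ->]]; exists (b * c + c'), (b *: x + x').
    congr (_, _); rewrite linearP /= scalerBr scalerDl scalerA.
    by rewrite opprD addrACA.
  - move=> _ [c [x ->]] /=; rewrite ler_pdivlMl//.
    have [->|c0] := eqVneq c 0; first by rewrite rnorm0 mulr0 rnorm_ge0.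
    have -> : c *: y - f x = c *: (y - f (c^-1 *: x)).
      by rewrite linearZ /= scalerBr scalerA divff// scale1r.
    by rewrite rnormZ mulrC ler_wpM2l ?rnorm_ge0.
  have phi0 : phi = 0.
    apply: fdense => x; apply: (phiRel (f x, 0)); exists 0, (- x).
    by rewrite linearN opprK scale0r add0r.
  have : Rel (1 *: y - f 0, 1) by exists 1, 0.
  by move=> /phiRel; rewrite phi0 /= => /esym/eqP; rewrite oner_eq0.
have /choice[x xy] n : exists x, rnorm (y - f x) < n.+1%:R^-1.
  by apply: close; rewrite invr_gt0 ltr0n.
have fxy : f \o x @ \oo --> y.
  apply/cvgrPdist_lt => _ /gt0_complexE[e e0 ->].
  near=> n; rewrite rnormE ltcR; apply: lt_trans (xy n) _.
  by near: n; exact: near_infty_natSinv_lt (PosNum e0).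
have : cvgn x.
  apply/cauchy_cvgP/cauchyP => _ /gt0_complexE[e e0 ->].
  (* Two images within [a * e / 2] of [y] differ by less than [a * e], hence their preimages by less
     than [e]. *)
  have ae2 : 0 < a * e / 2 by rewrite divr_gt0// mulr_gt0.
  have [n yn] := filter_ex (cvg_rnorm_close fxy ae2).
  exists (x n); have := cvg_rnorm_close fxy ae2; apply: filterS => m ym.
  rewrite -ball_normE /= rnormE ltcR -(ltr_pM2l a0).
  apply: le_lt_trans (fa _) _; rewrite linearB /=.
  have -> : f (x n) - f (x m) = (y - f (x m)) - (y - f (x n)).
    by rewrite opprB [RHS]addrC addrA subrK.
  apply: le_lt_trans (rnormD _ _) _.
  by rewrite [ltRHS]splitr ltrD// /rnorm normrN; exact: yn.
move=> /cvg_ex[x0 xx0]; exists x0.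
have fx : f \o x @ \oo --> f x0.
  apply/cvgrPdist_lt => _ /gt0_complexE[e e0 ->].
  (* The [+ 1] keeps the divisor positive when [f] is zero. *)
  have fe : 0 < e / (opnorm f + 1) by rewrite divr_gt0// ltr_pwDr ?opnorm_ge0.
  have := cvg_rnorm_close xx0 fe; apply: filterS => n.
  rewrite rnormE ltcR ltr_pdivlMr ?ltr_pwDr ?opnorm_ge0// => xn.
  rewrite /= -linearB; apply: le_lt_trans (opnorm_le _ _) _.
  by apply: le_lt_trans xn; rewrite mulrC ler_wpM2l ?rnorm_ge0 ?lerDl.
rewrite -(cvg_lim (@norm_hausdorff _ V) fxy).
by rewrite (cvg_lim (@norm_hausdorff _ V) fx).
Unshelve. all: by end_near. Qed.

End dense_range.

Lemma bop_scale (R : realType) (V W : normedModType R[i]) (f : bop V W) a x :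
  f (a *: x) = a *: f x.
Proof. exact: linearZ. Qed.

(** * Convergence and two-sided bounds for the multiplier *)

Section multiplier.
Variables (R : realType) (q : R) (q0 : 0 < q).
Variables (X1 X2 : completeNormedModType R[i]).
Variables (Y : nat -> completeNormedModType R[i]) (m : nat -> R[i]).
Variables (L : forall i, bop X2 (Y i)).
Variables (T : forall i, bop (dual X1) (dual (Y i))).
Variables A B D c C : R.
Hypotheses (A0 : 0 < A) (B0 : 0 < B) (c0 : 0 < c).
Hypotheses (cm : forall i, c <= rnorm (m i))
  (mC : forall i, rnorm (m i) <= C).
Hypothesis LAB : forall t F, uniq t ->
  A * seq_norm q t (fun i => rnorm (F i)) <= rnorm (synthesis L t F) <=
  B * seq_norm q t (fun i => rnorm (F i)).
Hypothesis TD : forall t g, uniq t ->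
  seq_norm q t (fun i => rnorm (T i g)) <= D * rnorm g.
Implicit Types (g : dual X1) (t : seq nat).

Local Notation term := (multiplier_term m L T).

Let C0 : 0 < C.
Proof. exact: lt_le_trans c0 (le_trans (cm 0%N) (mC 0%N)). Qed.

Let weighted g i : dual (Y i) := m i *: T i g.

Let termE g t : \sum_(i <- t) term g i = synthesis L t (weighted g).
Proof. by apply: eq_bigr => i _; rewrite /weighted bop_scale. Qed.

Let rnorm_weighted i g : rnorm (weighted g i) = rnorm (m i) * rnorm (T i g).
Proof. exact: rnormZ. Qed.

Let sum_term_le g t : uniq t ->
  rnorm (\sum_(i <- t) term g i) <=
  B * (C * seq_norm q t (fun i => rnorm (T i g))).
Proof.
move=> ut; rewrite termE -seq_normZ ?(ltW C0)//; last first.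
  by move=> i; exact: rnorm_ge0.
have /andP[_ h] := LAB (weighted g) ut; apply: (le_trans h).
apply: ler_wpM2l; first exact: ltW.
apply: le_seq_norm => // i; first exact: rnorm_ge0.
by rewrite rnorm_weighted ler_wpM2r ?rnorm_ge0.
Qed.

Let sum_term_ge g t : uniq t ->
  A * (c * seq_norm q t (fun i => rnorm (T i g))) <=
  rnorm (\sum_(i <- t) term g i).
Proof.
move=> ut; rewrite termE -seq_normZ ?(ltW c0)//; last first.
  by move=> i; exact: rnorm_ge0.
have /andP[h _] := LAB (weighted g) ut; apply: le_trans h.
apply: ler_wpM2l; first exact: ltW.
apply: le_seq_norm => // i; first by rewrite mulr_ge0 ?rnorm_ge0// ltW.
by rewrite rnorm_weighted ler_wpM2r ?rnorm_ge0.
Qed.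

(** By [TD] the [q]-th powers of [rnorm (T i g)] are summable, and the upper Riesz bound of [L]
    controls each block of the series by the same block of powers. *)
Lemma multiplier_series_cvg g : cvgn (series (term g)).
Proof.
pose a i := rnorm (T i g) `^ q.
have a_cvg : cvgn (series a).
  apply: nondecreasing_is_cvgn.
    by apply: nondecreasing_series => n _ _; exact: powR_ge0.
  exists ((D * rnorm g) `^ q) => _ [n _ <-].
  have := TD g (iota_uniq 0 (n - 0)) => h.
  rewrite -[leLHS]powRr1 ?sum_powR_ge0// -(mulVf (lt0r_neq0 q0)) powRrM.
  rewrite ge0_ler_powR ?(ltW q0) ?nnegrE ?seq_norm_ge0//.
  by rewrite (le_trans _ h) ?seq_norm_ge0.
apply/cauchy_cvgP/cauchy_seriesP => _ /gt0_complexE[e e0 ->].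
have BC : 0 < B * C by rewrite mulr_gt0.
(* The power [q] is undone by the outer exponent [q^-1] of [seq_norm]. *)
have e1 : 0 < (e / (B * C)) `^ q by rewrite powR_gt0 // divr_gt0.
move/cauchy_cvgP/cauchy_seriesP : a_cvg => /(_ _ e1).
apply: filterS => -[k n] /=; rewrite ger0_norm ?sum_powR_ge0// => akn.
rewrite rnormE ltcR; apply: le_lt_trans (sum_term_le _ (iota_uniq _ _)) _.
rewrite mulrA mulrC -ltr_pdivlMr// /seq_norm.
have -> : e / (B * C) = ((e / (B * C)) `^ q) `^ q^-1.
  by rewrite -powRrM mulfV ?gt_eqF// powRr1// divr_ge0// ltW.
by rewrite gt0_ltr_powR ?invr_gt0 ?nnegrE ?sum_powR_ge0 ?powR_ge0.
Qed.

Lemma multiplier_linear : linear (multiplier m L T : dual X1 -> dual X2).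
Proof.
move=> a f g; apply: (@cvg_lim _ (@norm_hausdorff _ (dual X2))).
have -> : series (term (a *: f + g)) =
    (fun n => a *: series (term f) n + series (term g) n).
  apply/funext => n; rewrite /series /= scaler_sumr -big_split /=.
  apply: eq_bigr => i _.
  by rewrite /multiplier_term !bop_linear scalerDr !scalerA [m i * a]mulrC.
by apply: cvgD; [apply: cvgZl_tmp|]; exact: multiplier_series_cvg.
Qed.

Lemma multiplier_bounded :
  (multiplier m L T : dual X1 -> dual X2) \in
    @bounded_operator R (dual X1) (dual X2).
Proof.
apply/bounded_operatorP; split; first exact: multiplier_linear.
exists (B * (C * D)) => g.
apply: (@rnorm_lim_le _ (dual X2) (series (term g))) => [|n].
  exact: multiplier_series_cvg.
apply: le_trans (sum_term_le _ (iota_uniq _ _)) _; rewrite -!mulrA.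
by rewrite !ler_wpM2l ?(ltW B0) ?(ltW C0)// TD// iota_uniq.
Qed.

(** Supplies the constant [K] of [moment_problem] for the data [T i g]. The lower bound on each
    partial sum beyond [n] dominates the segment up to [n], so it survives the limit. *)
Lemma multiplier_analysis_le g n :
  seq_norm q (index_iota 0 n) (fun i => rnorm (T i g)) <=
    rnorm (multiplier m L T g) / (A * c).
Proof.
have Ac : 0 < A * c by rewrite mulr_gt0.
rewrite ler_pdivlMr// mulrC -mulrA.
apply: (@le_rnorm_lim _ (dual X2) (series (term g)) _ _ n) => [|k nk].
  exact: multiplier_series_cvg.
apply: le_trans (sum_term_ge _ (iota_uniq _ _)).
rewrite !ler_wpM2l ?(ltW A0) ?(ltW c0)//.
rewrite /seq_norm ge0_ler_powR ?nnegrE ?sum_powR_ge0 ?invr_ge0 ?(ltW q0)//.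
by apply: (nondecreasing_series (P := xpredT)) nk => i _ _; exact: powR_ge0.
Qed.

End multiplier.

(** * Data supported at one index, and invertibility *)

Lemma multiplier_single (R : realType) (X1 X2 : completeNormedModType R[i])
    (Y : nat -> completeNormedModType R[i]) (m : nat -> R[i])
    (L : forall i, bop X2 (Y i)) (T : forall i, bop (dual X1) (dual (Y i)))
    (g : dual X1) j : (forall i, i != j -> T i g = 0) ->
  multiplier m L T g = multiplier_term m L T g j.
Proof.
move=> Tg; apply: (@cvg_lim _ (@norm_hausdorff _ (dual X2))).
apply: cvg_near_cst; exists j.+1 => // n /= jn.
rewrite /series /= (bigD1_seq j) ?mem_index_iota ?iota_uniq//=.
rewrite big1 ?addr0// => i ij.
by rewrite /multiplier_term Tg// linear0 scaler0.
Qed.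

(** Supplies the constant [K] of [moment_problem] for data supported at [j]; a segment with [n <= j]
    misses [j] and has norm zero. *)
Lemma seq_norm_single (R : realType) (V : nat -> normedModType R[i]) (q : R)
    (h : forall i, V i) j n : 0 < q -> (forall i, i != j -> h i = 0) ->
  seq_norm q (index_iota 0 n) (fun i => rnorm (h i)) <= rnorm (h j).
Proof.
move=> q0 hj; rewrite /seq_norm -[leRHS]powRr1 ?rnorm_ge0//.
rewrite -[in leRHS](mulfV (lt0r_neq0 q0)) powRrM.
rewrite ge0_ler_powR ?nnegrE ?invr_ge0 ?(ltW q0) ?sum_powR_ge0 ?powR_ge0//.
have h0 i : i != j -> rnorm (h i) `^ q = 0.
  by move=> ij; rewrite hj// rnorm0 powR0// gt_eqF.
have [jn|nj] := ltnP j n.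
  by rewrite (bigD1_seq j) ?mem_index_iota ?iota_uniq//= big1 ?addr0.
rewrite big_nat big1 ?powR_ge0// => i /andP[_ ilt].
by apply: h0; rewrite neq_ltn (leq_trans ilt).
Qed.

Theorem theorem3p8 (R : realType) (p q : R) (hp : 1 < p) (hq : 1 < q)
  (hpq : p^-1 + q^-1 = 1)
  (X1 X2 : completeNormedModType R[i]) (Y : nat -> completeNormedModType R[i])
  (hX1 : reflexive_space X1) (hX2 : reflexive_space X2)
  (hY : forall i, reflexive_space (Y i))
  (Lambda : forall i, bop X2 (Y i))
  (Theta : forall i, bop (dual X1) (dual (Y i)))
  (hLambda : g_Riesz_basis q Lambda) (hTheta : g_Riesz_basis p Theta)
  (m : nat -> R[i])
  (hm_inf : (0 < ereal_inf (range (fun i => (rnorm (m i))%:E)))%E)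
  (hm_sup : (ereal_sup (range (fun i => (rnorm (m i))%:E)) < +oo)%E) :
  (forall g : dual X1, cvgn (series (multiplier_term m Lambda Theta g))) /\
  invertible_operator (multiplier m Lambda Theta).
Proof.
have p0 : 0 < p by exact: lt_trans hp.
have q0 : 0 < q by exact: lt_trans hq.
have [c c0 cm] : exists2 c : R, 0 < c & forall i, c <= rnorm (m i).
  have im i :
      (ereal_inf (range (fun i => (rnorm (m i))%:E)) <= (rnorm (m i))%:E)%E.
    by apply: ereal_inf_lbound; exists i.
  case: ereal_inf hm_inf im => [c||] //= c0 im; last by have := im 0%N.
  by exists c => [|i]; [rewrite -lte_fin|rewrite -lee_fin].
have [C mC] : exists C : R, forall i, rnorm (m i) <= C.
  have mi i :
      ((rnorm (m i))%:E <= ereal_sup (range (fun i => (rnorm (m i))%:E)))%E.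
    by apply: ereal_sup_ubound; exists i.
  case: ereal_sup hm_sup mi => [C||] //= _ mi; last by have := mi 0%N.
  by exists C => i; rewrite -lee_fin.
have [A [B [A0 B0 LAB]]] := g_Riesz_basis_seq hLambda.
have [A' [B' [A'0 B'0 TAB]]] := g_Riesz_basis_seq hTheta.
(* [Theta] has exponent [p], so its analysis is bounded in the conjugate exponent [q], the one in
   which the synthesis of [Lambda] is bounded. *)
have TD : forall t g, uniq t ->
    seq_norm q t (fun i => rnorm (Theta i g)) <= B' * rnorm g.
  apply: (analysis_le p0 q0 hpq (ltW B'0)) => t F ut.
  by case/andP: (TAB t F ut).
(* The basis [Theta] lives on [dual X1], whose reflexivity is inherited from [X1]. *)
have solve K h hK := moment_problem p0 q0 hpq A'0 (dual_reflexive hX1)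
  (fun t F ut => proj1 (andP (TAB t F ut))) (K := K) (h := h) hK.
split; first by move=> g; exact: (multiplier_series_cvg q0 B0 c0 cm mC LAB TD).
have MB := multiplier_bounded q0 B0 c0 cm mC LAB TD.
pose M : bop (dual X1) (dual X2) := Bop MB.
have Ac : 0 < A * c by rewrite mulr_gt0.
(* The constant combines [K = rnorm (M g) / (A * c)] with the division by [A'] in the moment
   problem. *)
have Mge g : A' * (A * c) * rnorm g <= rnorm (M g).
  have [z zg zK] :=
    solve _ _ (multiplier_analysis_le q0 A0 B0 c0 cm mC LAB TD g).
  have gz : g = z.
    apply/eqP; rewrite -subr_eq0; apply/eqP; apply: (proj1 hTheta) => i.
    by rewrite linearB /= zg subrr.
  move: zK; rewrite -gz ler_pdivlMr// ler_pdivlMr// => zK.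
  rewrite [X in X <= _](_ : _ = rnorm g * A' * (A * c))//.
  by rewrite [LHS]mulrC [LHS]mulrA.
have Msurj : forall h, exists g, M g = h.
  apply: (bounded_below_surj _ Mge); first by rewrite mulr_gt0.
  move=> phi phiM; have [f fphi] := hX2 phi.
  suff -> : phi = bidual_map 0 by apply/bopP => x /=; rewrite linear0.
  rewrite -fphi; congr bidual_map; apply: (proj1 hLambda) => j.
  apply: dual_separates => y; rewrite linear0.
  (* Solving for data [y] at [j] and zero elsewhere gives [M g = m j *: adjoint (Lambda j) y]; as
     [m j] is nonzero, [phi (M g) = 0] forces [y (Lambda j f) = 0]. *)
  pose h := @dfwith nat (fun j => dual (Y j)) (fun=> 0) j y.
  have h0 i : i != j -> h i = 0 by move=> ij; rewrite /h dfwithout// eq_sym.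
  have [g gh _] := solve _ _ (fun n => seq_norm_single n q0 h0).
  have := phiM g; rewrite -fphi /= (@multiplier_single _ _ _ _ _ _ _ _ j);
    last by move=> i ij; rewrite gh h0.
  rewrite /multiplier_term gh /h dfwithin => /eqP.
  rewrite mulf_eq0 => /orP[/eqP mj|/eqP//].
  by have := cm j; rewrite mj rnorm0 leNgt c0.
have Minj : injective M.
  move=> g h Mgh; apply/eqP; rewrite -subr_eq0; apply/eqP/rnorm0_eq0.
  apply/eqP; rewrite eq_le rnorm_ge0 andbT.
  rewrite -(pmulr_rle0 _ (mulr_gt0 A'0 Ac)); apply: le_trans (Mge _) _.
  have -> : M (g - h) = M g - M h by exact: linearB.
  by rewrite Mgh subrr rnorm0.
split => //.
(* The inverse is chosen pointwise; injectivity of [M] makes it linear, and [Mge] bounds it by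
   [(A' * (A * c))^-1]. *)
pose S h := projT1 (cid (Msurj h)).
have MS h : M (S h) = h by rewrite /S; case: cid.
exists S; split => //.
- by move=> g; apply: Minj; rewrite MS.
apply/bounded_operatorP; split.
  by move=> a f g; apply: Minj; rewrite MS bop_linear !MS.
exists (A' * (A * c))^-1 => h; rewrite ler_pdivlMl ?mulr_gt0//.
by rewrite -{2}(MS h).
Qed.
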